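(* Let $A$ be a finite left brace, let $x\in A$, and let $A(x)$ be the smallest left brace contained in $A$ (with the same operations $+$ and $\circ$ as in $A$) which contains $x$. Put $X=\{x+a\cdot x : a\in A(x)\}$ and let $r:X\times X\to X\times X$ be the restriction of the Yang-Baxter map associated to $A$. Then $(X,r)$ is an indecomposable, non-degenerate, involutive set-theoretic solution of the quantum Yang-Baxter equation.
   Context: A set-theoretic solution of the quantum Yang-Baxter equation (QYBE) is a pair $(X,r)$ with $X$ a non-empty set and $r:X\times X\to X\times X$ a bijection, written $r(x,y)=(\sigma_x(y),\tau_y(x))$, satisfying $r_1r_2r_1=r_2r_1r_2$ on $X^3$, where $r_1=r\times \mathrm{id}_X$, $r_2=\mathrm{id}_X\times r$. It is non-degenerate if all $\sigma_x,\tau_x$ are permutations of $X$, and involutive if $r^2=\mathrm{id}$. A non-degenerate solution $(X,r)$ is decomposable if there are non-empty disjoint subsets $X_1,X_2\subseteq X$ with $X=X_1\cup X_2$ and $r(X_i\times X_j)=X_j\times X_i$ for all $i,j\in\{1,2\}$; otherwise it is indecomposable. A left brace is an abelian group $(A,+)$ with a multiplication $\cdot$ such that $a\cdot(b+c)=a\cdot b+a\cdot c$ and the operation $a\circ b=a\cdot b+a+b$ makes $A$ a group. The Yang-Baxter map associated to $A$ is $r':A\times A\to A\times A$, $r'(x,y)=(x\cdot y+y,\ z\cdot x+x)$, where $z$ is the unique element with $z\cdot(x\cdot y+y)+z+x\cdot y+y=0$. A map $r:X\times X\to X\times X$ with $X\subseteq A$ is a restriction of $r'$ if $r(x,y)=r'(x,y)$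 for all $x,y\in X$. *)

(* Defs.v *)
From HB Require Import structures.
From mathcomp Require Import all_boot all_order all_algebra.
From mathcomp Require Import boolp classical_sets.

Set Implicit Arguments.
Unset Strict Implicit.
Unset Printing Implicit Defensive.

Import GRing.Theory.

Local Open Scope ring_scope.
Local Open Scope classical_set_scope.

Section Solutions.
Variables (T : Type) (r : T * T -> T * T).

Definition r12 (p : T * T * T) : T * T * T :=
  let: (x, y, z) := p in let: (x', y') := r (x, y) in (x', y', z).

Definition r23 (p : T * T * T) : T * T * T :=
  let: (x, y, z) := p in let: (y', z') := r (y, z) in (x, y', z').

Definition yb_solution : Prop :=
  [/\ inhabited T, bijective r & r12 \o r23 \o r12 =1 r23 \o r12 \o r23].

(* r (x, y) = (ybsigma x y, ybtau y x) *)
Definition ybsigma (x y : T) : T := (r (x, y)).1.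
Definition ybtau (y x : T) : T := (r (x, y)).2.

Definition yb_nondegenerate : Prop :=
  (forall x, bijective (ybsigma x)) /\ (forall y, bijective (ybtau y)).

Definition yb_decomposable : Prop :=
  exists X : bool -> set T,
    [/\ forall i, X i !=set0,
        X true `&` X false = set0,
        X true `|` X false = setT
      & forall i j, r @` (X i `*` X j) = X j `*` X i].

Definition yb_indecomposable : Prop := ~ yb_decomposable.

End Solutions.

Definition is_group (T : Type) (op : T -> T -> T) : Prop :=
  associative op /\
  exists e, [/\ left_id e op, right_id e op
              & forall a, exists b, op a b = e /\ op b a = e].

HB.mixin Record isLeftBrace A of GRing.Zmodule A := {
  dot : A -> A -> A;
  dotDr : forall a b c, dot a (b + c) = dot a b + dot a c;
  circ_is_group : is_group (fun a b => dot a b + a + b)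
}.

#[short(type="leftBraceType")]
HB.structure Definition LeftBrace := {A of isLeftBrace A & GRing.Zmodule A}.

#[short(type="finLeftBraceType")]
HB.structure Definition FinLeftBrace := {A of LeftBrace A & Finite A}.

Section LeftBraceTheory.
Variable A : leftBraceType.
Implicit Types (a b x y z u : A) (B : set A).

Definition circ a b : A := dot a b + a + b.

Lemma dotr0 a : dot a 0 = 0.
Proof. by apply: (addIr (dot a 0)); rewrite -dotDr !add0r. Qed.

Lemma circ_linv_exists u : exists z, dot z u + z + u == 0.
Proof.
have [_ [e [le _ inv]]] := @circ_is_group A.
have e0 : e = 0 by have := le 0; rewrite dotr0 add0r addr0.
by have [z [_ zu]] := inv u; exists z; rewrite zu e0.
Qed.

(* The inverse of u in (A, circ), whose neutral element is 0 *)
Definition circ_inv u : A := xchoose (circ_linv_exists u).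

Lemma circ_invP u : dot (circ_inv u) u + circ_inv u + u = 0.
Proof. exact/eqP/(xchooseP (circ_linv_exists u)). Qed.

Lemma circ_inv_unique u z : dot z u + z + u = 0 -> z = circ_inv u.
Proof.
move=> zu; have [cA [e [le re inv]]] := @circ_is_group A.
have e0 : e = 0 by have := le 0; rewrite dotr0 add0r addr0.
have [w [uw _]] := inv u.
have := cA z u w; have := cA (circ_inv u) u w.
by rewrite /= uw re circ_invP zu -e0 re le => -> ->.
Qed.

Definition yb_map (p : A * A) : A * A :=
  let: (x, y) := p in
  let u := dot x y + y in (u, dot (circ_inv u) x + x).

(* B is a subgroup of both (A, +) and (A, circ) *)
Definition subbrace (B : set A) : Prop :=
  [/\ B 0,
      forall a b, B a -> B b -> B (a - b),
      forall a b, B a -> B b -> B (circ a b)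
    & forall a, B a -> B (circ_inv a)].

Definition generated_subbrace x : set A := smallest subbrace [set x].

Lemma subbrace_generated x : subbrace (generated_subbrace x).
Proof.
split=> [B [[]]//|a b Ba Bb B SB|a b Ba Bb B SB|a Ba B SB];
  have [[_ sB cB iB] _] := SB.
- by apply: sB; [apply: Ba | apply: Bb].
- by apply: cB; [apply: Ba | apply: Bb].
- by apply: iB; apply: Ba.
Qed.

Definition brace_orbit x : set A :=
  [set x + dot a x | a in generated_subbrace x].

Definition yb_restriction (X : set A) (r : X * X -> X * X) : Prop :=
  forall u v : X,
    (val (r (u, v)).1, val (r (u, v)).2) = yb_map (val u, val v).

End LeftBraceTheory.

(* Main.v *)
Require Import Defs.
From mathcomp Require Import all_boot all_order all_algebra.
From mathcomp Require Import boolp classical_sets.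

(** The proof rests on the maps [lambda a b = a . b + b].  They are additive,
    and [lambda] is an action of the group [(A, circ)] on [(A, +)]; the two laws
    determine each other through [circ a b = a + lambda a b].  The set of the
    theorem is the orbit of [x] under the action of the subbrace generated by
    [x].

    Write [yb_map (a, b) = (lambda a b, tau b a)].  Two observations give all
    that is needed about this map.  It preserves the circle product:
    [circ (lambda a b) (tau b a) = circ a b] ([circ_yb_map]).  And [tau] is
    [lambda] conjugated by circle inversion,
    [tau b a = (lambda b^-1 a^-1)^-1] ([tauE]), hence a right action of
    [(A, circ)].  In the braid relation the two sides agree in the first
    coordinate because [lambda] is an action, in the last one because [tau] is,
    and in the middle one because the product of all three is preserved and can
    be cancelled.  The orbit is stable under [lambda a] for [a] in the generated
    subbrace, which contains the orbit, so the map restricts to it; injectivity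
    of each [tau b] gives bijectivity on the orbit by finiteness.

    For indecomposability, the blocks of a decomposition are stable under
    [lambda u] for every [u] in the orbit.  The elements of the generated
    subbrace whose [lambda] preserves the blocks form a circle subgroup
    containing the orbit, and the key fact ([orbit_circ_generates]) is that such
    a subgroup is the whole subbrace.  As the subbrace acts transitively on the
    orbit, one block is empty. *)

Set Implicit Arguments.
Unset Strict Implicit.
Unset Printing Implicit Defensive.

Import GRing.Theory.

Local Open Scope ring_scope.
Local Open Scope classical_set_scope.

(** * The action lambda of the circle group of a left brace *)

Section Lambda.
Variable A : leftBraceType.
Implicit Types a b c : A.

Definition lambda a b : A := dot a b + b.

Lemma circE a b : circ a b = a + lambda a b.
Proof. by rewrite /circ /lambda addrCA addrA. Qed.

Lemma circA a b c : circ a (circ b c) = circ (circ a b) c.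
Proof. by have [cA _] := @circ_is_group A; exact: cA. Qed.

Lemma circ0r a : circ 0 a = a.
Proof.
have [_ [e [le _ _]]] := @circ_is_group A.
have e0 : e = 0 by have := le 0; rewrite dotr0 add0r addr0.
by have := le a; rewrite e0.
Qed.

Lemma circr0 a : circ a 0 = a.
Proof. by rewrite /circ dotr0 add0r addr0. Qed.

Lemma circVr a : circ (circ_inv a) a = 0.
Proof. exact: circ_invP. Qed.

Lemma circrV a : circ a (circ_inv a) = 0.
Proof.
rewrite -[LHS]circ0r -(circVr (circ_inv a)) -circA.
by rewrite [circ _ (circ a _)]circA circVr circ0r.
Qed.

Lemma circKV a : cancel (circ a) (circ (circ_inv a)).
Proof. by move=> b; rewrite circA circVr circ0r. Qed.

Lemma circ_injr a : injective ((@circ A)^~ a).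
Proof.
move=> b c /(congr1 ((@circ A)^~ (circ_inv a))).
by rewrite /= -!circA circrV !circr0.
Qed.

Lemma circ_invK : involutive (@circ_inv A).
Proof. by move=> a; apply/esym/circ_inv_unique; exact: circrV. Qed.

Lemma circ_invM a b : circ_inv (circ a b) = circ (circ_inv b) (circ_inv a).
Proof.
apply/esym/circ_inv_unique.
by rewrite -/(circ _ _) -circA (circA _ a) circVr circ0r circVr.
Qed.

Lemma lambdaD a b c : lambda a (b + c) = lambda a b + lambda a c.
Proof. by rewrite /lambda dotDr addrACA. Qed.

Lemma lambda0r a : lambda a 0 = 0.
Proof. by rewrite /lambda dotr0 addr0. Qed.

Lemma lambdaN a b : lambda a (- b) = - lambda a b.
Proof. by apply/eqP; rewrite -addr_eq0 -lambdaD addNr lambda0r. Qed.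

Lemma lambda_id b : lambda 0 b = b.
Proof. by rewrite -[LHS]add0r -circE circ0r. Qed.

(** Associativity of [circ], read through [circE] and additivity. *)
Lemma lambdaM a b c : lambda (circ a b) c = lambda a (lambda b c).
Proof.
apply: (addrI (circ a b)); rewrite -circE -circA (circE b) circE lambdaD addrA.
by rewrite -circE.
Qed.

Lemma lambdaK a : cancel (lambda a) (lambda (circ_inv a)).
Proof. by move=> b; rewrite -lambdaM circVr lambda_id. Qed.

Lemma lambdaVK a : cancel (lambda (circ_inv a)) (lambda a).
Proof. by move=> b; rewrite -lambdaM circrV lambda_id. Qed.

Lemma circ_invE a : circ_inv a = - lambda (circ_inv a) a.
Proof. by apply/eqP; rewrite -addr_eq0 -circE circVr. Qed.

Lemma addE_circ a b : a + b = circ a (lambda (circ_inv a) b).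
Proof. by rewrite circE lambdaVK. Qed.

(** * The Yang-Baxter map of a left brace *)

Definition tau b a : A := lambda (circ_inv (lambda a b)) a.

Lemma yb_mapE a b : yb_map (a, b) = (lambda a b, tau b a).
Proof. by []. Qed.

Lemma circ_yb_map a b : circ (lambda a b) (tau b a) = circ a b.
Proof. by rewrite [LHS]circE lambdaVK addrC -circE. Qed.

(** The circle inverse of [tau b a] is [b^-1 o (a^-1 o lambda a b)] since circle
    products are preserved, and [a^-1 o lambda a b = a^-1 + b]. *)
Lemma tauE b a : tau b a = circ_inv (lambda (circ_inv b) (circ_inv a)).
Proof.
apply: (can_inj circ_invK); rewrite circ_invK.
have -> : tau b a = circ (circ_inv (lambda a b)) (circ a b).
  by rewrite -(circ_yb_map a b) circKV.
rewrite !circ_invM circ_invK -circA (circE (circ_inv a)) lambdaK.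
by rewrite circE lambdaD addrCA -circE circVr addr0.
Qed.

Lemma tauM b c a : tau (circ b c) a = tau c (tau b a).
Proof. by rewrite !tauE circ_invK circ_invM lambdaM. Qed.

Lemma tau_inj b : injective (tau b).
Proof.
move=> a a'; rewrite !tauE => /(can_inj circ_invK).
by move=> /(can_inj (lambdaK _)) /(can_inj circ_invK).
Qed.

Lemma yb_map_invol : involutive (@yb_map A).
Proof. by case=> a b; rewrite !yb_mapE {2}/tau !lambdaVK lambdaK. Qed.

Lemma yb_map_braid :
  r12 (@yb_map A) \o r23 (@yb_map A) \o r12 (@yb_map A)
    =1 r23 (@yb_map A) \o r12 (@yb_map A) \o r23 (@yb_map A).
Proof.
case=> [[a b] c]; rewrite /= -!/(lambda _ _) -!/(tau _ _).
set p := lambda (lambda a b) _; set q := tau _ (lambda a b).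
set p' := lambda a (lambda b c); set q' := lambda (tau _ a) _.
set s := tau c (tau b a); set s' := tau (tau c b) _.
have pE : p = p' by rewrite /p -lambdaM circ_yb_map lambdaM.
have sE : s = s' by rewrite /s /s' -!tauM circ_yb_map.
suff -> : q = q' by rewrite pE sE.
apply: (@circ_injr s); apply: (can_inj (circKV p)).
rewrite circA circ_yb_map -[LHS]circA circ_yb_map circA circ_yb_map.
by rewrite sE circ_yb_map pE circA circ_yb_map -!circA circ_yb_map.
Qed.

End Lambda.

(** * The orbit of an element under its generated subbrace *)

Section Orbit.
Variables (A : leftBraceType) (x : A).
Implicit Types a b c u v : A.

Local Notation Ax := (generated_subbrace x).
Local Notation X := (brace_orbit x).

Lemma brace_orbitP u : X u <-> exists2 a, Ax a & u = lambda a x.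
Proof.
by split=> -[a Aa ua]; exists a; rewrite // -?ua ?ua /lambda addrC.
Qed.

Lemma generated_subbrace_mem : Ax x.
Proof. by move=> B [_ sub]; apply: sub. Qed.

Lemma generated_subbrace_min (B : set A) : subbrace B -> B x -> Ax `<=` B.
Proof. by move=> sB Bx; apply: smallest_sub => // _ ->. Qed.

Lemma generated_subbrace0 : Ax 0.
Proof. by have [] := subbrace_generated x. Qed.

Lemma generated_subbraceB a b : Ax a -> Ax b -> Ax (a - b).
Proof. by have [_ AB _ _] := subbrace_generated x; exact: AB. Qed.

Lemma generated_subbraceM a b : Ax a -> Ax b -> Ax (circ a b).
Proof. by have [_ _ AM _] := subbrace_generated x; exact: AM. Qed.

Lemma generated_subbraceV a : Ax a -> Ax (circ_inv a).
Proof. by have [_ _ _ AV] := subbrace_generated x; exact: AV. Qed.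

Lemma generated_subbrace_lambda a b : Ax a -> Ax b -> Ax (lambda a b).
Proof.
move=> Aa Ab; have := generated_subbraceB (generated_subbraceM Aa Ab) Aa.
by rewrite circE [X in Ax X]addrC addKr.
Qed.

Lemma brace_orbit_sub : X `<=` Ax.
Proof.
move=> u /brace_orbitP[a Aa ->].
exact: generated_subbrace_lambda Aa generated_subbrace_mem.
Qed.

Lemma brace_orbit_lambda a u : Ax a -> X u -> X (lambda a u).
Proof.
move=> Aa /brace_orbitP[b Ab ->]; apply/brace_orbitP.
by exists (circ a b); [exact: generated_subbraceM | rewrite lambdaM].
Qed.

Lemma brace_orbit_mem : X x.
Proof.
by apply/brace_orbitP; exists 0; rewrite ?lambda_id //; exact: generated_subbrace0.
Qed.

Lemma brace_orbit_tau u v : X u -> X v -> X (tau v u).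
Proof.
move=> Xu Xv; apply: (brace_orbit_lambda _ Xu).
apply: generated_subbraceV; apply: brace_orbit_sub.
exact: brace_orbit_lambda (brace_orbit_sub Xu) Xv.
Qed.

(** A circle subgroup [S] containing the orbit absorbs addition of an orbit
    element [u], since [a + u = a o lambda a^-1 u] and [lambda a^-1 u] is again
    in the orbit.  So the [b] all of whose translates [lambda c b] can be added
    to and subtracted from elements of [S] form a subbrace containing [x]; it
    is everything, and adding its elements to [0] stays in [S]. *)
Lemma orbit_circ_generates (S : set A) :
    S `<=` Ax -> X `<=` S -> S 0 ->
    (forall a b, S a -> S b -> S (circ a b)) ->
    (forall a, S a -> S (circ_inv a)) ->
  Ax `<=` S.
Proof.
move=> SA XS S0 SM SV; have [A0 AB AM AV] := subbrace_generated x.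
have XL c u : Ax c -> X u -> S (lambda c u).
  by move=> Ac Xu; apply: XS; apply: brace_orbit_lambda.
pose H b := Ax b /\ forall c a, Ax c -> S a ->
  S (a + lambda c b) /\ S (a - lambda c b).
suff AH : Ax `<=` H.
  by move=> b /AH[_ /(_ _ _ A0 S0)[]]; rewrite lambda_id add0r.
apply: generated_subbrace_min; last first.
  split; first exact: generated_subbrace_mem.
  move=> c a Ac Sa; have Aa := SA _ Sa.
  have Xu : X (lambda c x) by apply/brace_orbitP; exists c.
  split; first by rewrite addE_circ; apply: SM Sa (XL _ _ (AV _ Aa) Xu).
  (* [d + u = a] reads [d o w = a] with [w] in the orbit, so [d = a o w^-1] *)
  set u := lambda c x in Xu *; set d := a - u.
  pose w := lambda (circ_inv d) u.
  have Ad : Ax d by apply: AB Aa (brace_orbit_sub Xu).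
  have dw : circ d w = a by rewrite -addE_circ subrK.
  have -> : d = circ a (circ_inv w) by rewrite -dw -circA circrV circr0.
  exact: SM Sa (SV _ (XL _ _ (AV _ Ad) Xu)).
split.
- by split=> // c a _ Sa; rewrite lambda0r subr0 addr0.
- move=> b b' [Ab Hb] [Ab' Hb']; split; first exact: AB.
  move=> c a Ac Sa; rewrite lambdaD lambdaN (opprD (lambda c b)) opprK (addrA a (lambda c b)) (addrA a (- _)).
  have [Sp Sm] := Hb c a Ac Sa.
  by split; [case: (Hb' _ _ Ac Sp) | case: (Hb' _ _ Ac Sm)].
- move=> b b' [Ab Hb] [Ab' Hb']; split; first exact: AM.
  move=> c a Ac Sa; rewrite circE lambdaD -lambdaM (opprD (lambda c b)) (addrA a (lambda c b)) (addrA a (- _)).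
  have [Sp Sm] := Hb c a Ac Sa; have Acb := AM _ _ Ac Ab.
  by split; [case: (Hb' _ _ Acb Sp) | case: (Hb' _ _ Acb Sm)].
- move=> b [Ab Hb]; split; first exact: AV.
  move=> c a Ac Sa; rewrite circ_invE lambdaN -lambdaM opprK.
  by apply/and_comm; apply: Hb => //; apply: AM => //; apply: AV.
Qed.

(** * The restriction of the Yang-Baxter map to the orbit *)

Lemma val_brace_orbit (u : X) : X (val u).
Proof. exact/set_mem/(valP u). Qed.

Definition orbit_elt u (Xu : X u) : X := exist _ u (mem_set Xu).

Definition orbit_map (p : X * X) : X * X :=
  let Xu := val_brace_orbit p.1 in
  let Xv := val_brace_orbit p.2 in
  (orbit_elt (brace_orbit_lambda (brace_orbit_sub Xu) Xv),
   orbit_elt (brace_orbit_tau Xu Xv)).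

Lemma orbit_mapP : yb_restriction orbit_map.
Proof. by []. Qed.

Lemma orbit_map_invol : involutive orbit_map.
Proof.
case=> u v; have := yb_map_invol (val u, val v).
by rewrite !yb_mapE => -[e1 e2]; congr pair; apply: val_inj.
Qed.

Lemma orbit_map_solution : yb_solution orbit_map.
Proof.
split; first exact: (inhabits (orbit_elt brace_orbit_mem)).
  exact: inv_bij orbit_map_invol.
case=> [[u v] w]; have := yb_map_braid (val u, val v, val w).
by move=> [e1 e2 e3]; congr (_, _, _); apply: val_inj.
Qed.

(** As [lambda u v] is the first coordinate of the image of [(u, v)], and the
    map sends [Xi x Xj] to [Xj x Xi], either block of a decomposition is stable
    under [lambda u] for [u] in the orbit, hence, by [orbit_circ_generates],
    under the transitive action of the generated subbrace; so membership of [x]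
    in a block decides that of every element. *)
Lemma orbit_map_indecomposable : yb_indecomposable orbit_map.
Proof.
move=> [Y [Yne Ydisj Ycov Yr]].
have Ycase (u : X) : exists i, Y i u.
  by have : [set: X] u by []; rewrite -Ycov => -[]; [exists true | exists false].
have Yneq (u : X) : Y true u -> Y false u -> False.
  by move=> Yt Yf; have : set0 u by rewrite -Ydisj.
pose P i a := exists2 u : X, Y i u & val u = a.
have Pstep i u a : X u -> P i a -> P i (lambda u a).
  move=> Xu [v Yv <-]; have [j Yj] := Ycase (orbit_elt Xu).
  have : (Y i `*` Y j) (orbit_map (orbit_elt Xu, v)).
    by rewrite -Yr; exists (orbit_elt Xu, v).
  by case=> Yi _; exists (orbit_map (orbit_elt Xu, v)).1.
pose S a := Ax a /\ forall w, X w -> P true w <-> P true (lambda a w).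
have SA : Ax `<=` S.
  apply: orbit_circ_generates.
  - by move=> a [].
  - move=> u Xu; split; first exact: brace_orbit_sub.
    move=> w Xw; split=> [|[v Yv vE]]; first exact: Pstep.
    (* were [w] in the other block, [lambda u w] would be in it too *)
    have [[] Yw] := Ycase (orbit_elt Xw); first by exists (orbit_elt Xw).
    have [|v' Yv' v'E] := Pstep false u w Xu; first by exists (orbit_elt Xw).
    by case: (Yneq v) => //; rewrite (_ : v = v') //; apply: val_inj; rewrite vE.
  - split=> [|w _]; [exact: generated_subbrace0 | by rewrite lambda_id].
  - move=> a b [Aa Sa] [Ab Sb]; split; first exact: generated_subbraceM.
    move=> w Xw; rewrite lambdaM (Sb w Xw).
    by apply: Sa; exact: brace_orbit_lambda.
  - move=> a [Aa Sa]; have AVa := generated_subbraceV Aa.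
    split=> // w Xw; rewrite (Sa (lambda _ w)) ?lambdaVK //.
    exact: brace_orbit_lambda.
have Px (u : X) : Y true u <-> P true x.
  have /brace_orbitP[a Aa uE] := val_brace_orbit u.
  have [_ /(_ x brace_orbit_mem) ->] := SA a Aa; rewrite -uE.
  by split=> [Yu|[v Yv /val_inj <-]]; [exists u|].
have [u Yu] := Yne true; have [v Yv] := Yne false.
by apply: (Yneq v) Yv; apply/Px/(Px u).
Qed.

End Orbit.

(** Finiteness enters here: it makes the injective maps [tau b], whose inverses
    need not visibly preserve the orbit, bijective on it. *)
Lemma orbit_map_nondegenerate (A : finLeftBraceType) (x : A) :
  yb_nondegenerate (@orbit_map A x).
Proof.
pose F : finType := {u : A | u \in brace_orbit x}.
split=> u; apply: (@injF_bij F) => v w /(congr1 val) /= e; apply: val_inj.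
  exact: can_inj (lambdaK (val u)) _ _ e.
exact: tau_inj e.
Qed.

Theorem theorem28 (A : finLeftBraceType) (x : A) :
  exists r : brace_orbit x * brace_orbit x -> brace_orbit x * brace_orbit x,
    yb_restriction r /\
    [/\ yb_solution r, yb_indecomposable r, yb_nondegenerate r & involutive r].
Proof.
exists (@orbit_map A x); split; first exact: orbit_mapP.
split; [exact: orbit_map_solution | exact: orbit_map_indecomposable | |].
  exact: orbit_map_nondegenerate.
exact: orbit_map_invol.
Qed.
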